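(* Let $(P,\leq,{}')$ be a poset with a unary operation ${}'$, and define binary operations on $2^P$ by $M(A,B)=L(A,B)$ and $R(A,B)=L(U(B,A'))$. Then: (a) the condition ''$L(A)\subseteq L(U(L(A,B),B'))$ for all $A,B\subseteq P$'' is equivalent to the condition ''for all $A,B,C\subseteq P$, $M(A,B)\subseteq L(C)$ implies $L(A)\subseteq R(B,C)$''; (b) the condition ''$L(U(A,B'),B)\subseteq L(A)$ for all $A,B\subseteq P$'' is equivalent to the condition ''for all $A,B,C\subseteq P$, $L(A)\subseteq R(B,C)$ implies $M(A,B)\subseteq L(C)$''.
   Context: For a poset $(P,\leq)$ and $A\subseteq P$ let $L(A)=\{x\in P\mid x\leq a\text{ for all }a\in A\}$ and $U(A)=\{x\in P\mid a\leq x\text{ for all }a\in A\}$; when several subsets are listed as arguments the union of them is meant, e.g. $L(A,B)=L(A\cup B)$, $U(B,A')=U(B\cup A')$, $L(U(L(A,B),B'))=L(U(L(A\cup B)\cup B'))$, $L(U(A,B'),B)=L(U(A\cup B')\cup B)$. For $A\subseteq P$, $A'=\{a'\mid a\in A\}$.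
   Formalization: In (a), the second condition is required only for nonempty C: with C empty the equivalence fails, e.g. for P = {0<1} with Boolean complement and A = B = C = ∅, where the inclusion holds but L(A) = P is not contained in R(B,C) = {0}. *)

(* Defs.v *)
From mathcomp Require Import all_boot all_order.
From mathcomp Require Import boolp classical_sets.

Set Implicit Arguments.
Unset Strict Implicit.
Unset Printing Implicit Defensive.

Local Open Scope classical_set_scope.

(* L(A) and U(A) are the library's [lbound A] and [ubound A]; they are the
   whole poset when A is empty.  Several arguments stand for their union, and
   A' is the direct image [compl @` A] under the unary operation [compl], on
   which nothing is assumed.

   Pitfall: "M(A,B) <= L(C) implies L(A) <= R(B,C)" is a degenerate requirement
   when C is empty, since then L(C) is everything while R(B,C) = L(U(B')).  On
   [bool] with [negb], L(A) <= L(U(L(A,B),B')) holds for all A and B, yet for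
   A = B = C = set0 this implication fails.  Its equivalence with that inclusion
   is therefore meant for nonempty C. *)

Definition opM (d : Order.disp_t) (P : porderType d) (A B : set P) : set P :=
  lbound (A `|` B).

Definition opR (d : Order.disp_t) (P : porderType d) (compl : P -> P)
    (A B : set P) : set P :=
  lbound (ubound (B `|` compl @` A)).

(* Main.v *)
Require Import Defs.
From mathcomp Require Import all_boot all_order.
From mathcomp Require Import boolp classical_sets.

Import Order.POrderTheory.

Local Open Scope classical_set_scope.

(** Each inclusion is its implication at an extremal choice of sets; conversely, the implication
    follows by comparing the upper bounds of [C] and B' with those in the inclusion. *)

Theorem theorem3 (d : Order.disp_t) (P : porderType d) (compl : P -> P) :
  ((forall A B : set P,
      lbound A `<=` lbound (ubound (lbound (A `|` B) `|` compl @` B)))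
   <->
   (forall A B C : set P, C !=set0 ->
      opM A B `<=` lbound C -> lbound A `<=` opR compl B C))
  /\
  ((forall A B : set P,
      lbound (ubound (A `|` compl @` B) `|` B) `<=` lbound A)
   <->
   (forall A B C : set P,
      lbound A `<=` opR compl B C -> opM A B `<=` lbound C)).
Proof.
split; split.
- move=> inclL A B C [c Cc] MC x Ax u Uu.
  apply: (inclL A B x Ax) => y [My|By]; last by apply: Uu; right.
  (* Any element c of [C] gives y <= c <= u. *)
  by apply: le_trans (Uu c _); [exact: MC | left].
- (* Taking C = {u} turns membership of u in U(L(A,B),B') into M(A,B) <= L(C). *)
  move=> adj A B x Ax u Uu.
  apply: (adj A B [set u] _ _ x Ax) => [|y My _ ->|y [->|By]].
  + by exists u.
  + by apply: Uu; left.
  + exact: lexx.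
  + by apply: Uu; right.
- move=> inclL A B C AR x ABx.
  (* [C] takes the role of [A] in [inclL]. *)
  apply: (inclL C B) => y [Uy|By]; last by apply: ABx; right.
  by apply: (AR x) Uy => a Aa; apply: ABx; left.
(* With U(A,B') as first set and [A] as third, the premise is L(U(A,B')) included in itself. *)
- by move=> adj A B; apply: (adj (ubound (A `|` compl @` B))).
Qed.
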